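(* Let $G$ be a $3$-colored graph on $n$ vertices, let $G'$ be the union of those connected components of $G$ that contain no colored vertex, and let $\delta$ denote the number of bipartite connected components of $G'$. Then the rank of $G$ equals $n-\delta$.
   Context: Graphs are finite and simple. A $3$-colored graph is a graph $G=(V,E)$ together with a color function $\gamma:V\to\{1,-1,0\}$; a vertex $v$ is called colorless if $\gamma(v)=0$ and colored if $\gamma(v)\in\{1,-1\}$. Let $V=\{1,\dots,n\}$ and order the edges. Let $\mathbf e_j\in\mathbb R^n$ denote the row vector with $1$ in position $j$ and $0$ elsewhere. The c-incidence matrix $J_G$ is the real $(|E|+n)\times n$ matrix whose first $|E|$ rows are the vectors $\mathbf e_i+\mathbf e_j$, one for each edge $\{i,j\}\in E$ (the transpose of the unsigned incidence matrix), and whose last $n$ rows are $\gamma(1)\mathbf e_1,\dots,\gamma(n)\mathbf e_n$. The rank of $G$ is the rank of $J_G$ over $\mathbb R$ (independent of the orderings). An isolated colorless vertex is a bipartite component. *)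

(* Defs.v *)
From mathcomp Require Import all_boot all_order all_algebra.
From mathcomp Require Import reals.
Set Implicit Arguments.
Unset Strict Implicit.
Unset Printing Implicit Defensive.
Import GRing.Theory Num.Theory.
Local Open Scope ring_scope.

Record colored_graph (n : nat) := ColoredGraph {
  edges : {set {set 'I_n}};
  edges_card2 : {in edges, forall e : {set 'I_n}, #|e| = 2%N};
  color : 'I_n -> int;
  colorP : forall v, color v \in [:: 1; -1; 0]
}.

Definition colored n (G : colored_graph n) (v : 'I_n) : bool :=
  (color G v == 1) || (color G v == -1).

(* The edges are ordered by [enum_val]; another order permutes the rows. Each
   edge is a set {i, j} with i <> j, so its row is e_i + e_j. *)
Definition c_incidence (R : realType) n (G : colored_graph n) :
    'M[R]_(#|edges G| + n, n) :=
  col_mx (\matrix_(k < #|edges G|) \sum_(v in enum_val k) delta_mx 0 v)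
         (\matrix_(v < n) ((color G v)%:~R *: delta_mx 0 v)).

Definition c_rank (R : realType) n (G : colored_graph n) : nat :=
  \rank (c_incidence R G).

(* A set W of vertices stands for the subgraph of G induced on W. *)
Definition adj_in n (G : colored_graph n) (W : {set 'I_n}) : rel 'I_n :=
  [rel x y | [&& x \in W, y \in W & [set x; y] \in edges G]].

Definition components n (G : colored_graph n) (W : {set 'I_n}) :
    {set {set 'I_n}} :=
  equivalence_partition (connect (adj_in G W)) W.

(* In particular a one-vertex component is bipartite. *)
Definition bipartite n (G : colored_graph n) (W : {set 'I_n}) : bool :=
  [exists A : {set 'I_n}, forall x, forall y,
     adj_in G W x y ==> ((x \in A) != (y \in A))].

(* The vertex set of the union of the components without colored vertex; a union
   of components is an induced subgraph, so this set determines it. *)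
Definition colorless_part n (G : colored_graph n) : {set 'I_n} :=
  \bigcup_(C in components G [set: 'I_n] | [forall v in C, ~~ colored G v]) C.

Definition delta n (G : colored_graph n) : nat :=
  #|[set C in components G (colorless_part G) | bipartite G C]|.

(* Main.v *)
(** A row vector [x] is in the kernel of [J_G] iff [x_i + x_j = 0] on every edge
    and [x_v = 0] at every colored vertex. Hence [|x|] is constant on each
    component, and it vanishes on a component that has a colored vertex; on a
    component without colored vertices, a nonzero solution yields the
    bipartition [{x > 0}], [{x < 0}], and conversely a bipartition gives a
    solution with entries [1] and [-1], unique up to a scalar. The kernel thus
    has a basis indexed by the bipartite components of [G']. *)
Require Import Defs.
From mathcomp Require Import all_boot all_order all_algebra.
From mathcomp Require Import reals.
Import GRing.Theory Num.Theory.
Local Open Scope ring_scope.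

(** Rank-nullity, with the rows of [K] as a basis of the kernel: the right inverse [L] makes them
    independent, and [x *m L] lists the coordinates of a kernel vector [x]. *)
Lemma mxrank_ker_basis (F : fieldType) (m n k : nat) (M : 'M[F]_(m, n))
    (K : 'M[F]_(k, n)) (L : 'M[F]_(n, k)) :
  (forall i, M *m (row i K)^T = 0) -> K *m L = 1%:M ->
  (forall x : 'rV_n, M *m x^T = 0 -> x = x *m L *m K) ->
  (\rank M + k = n)%N.
Proof.
move=> MK KL kerM.
have rankK : \rank K = k by apply/eqP/row_freeP; exists L.
have eqK : (kermx M^T == K)%MS.
  apply/andP; split; apply/rV_subP => x.
    move/sub_kermxP => /(congr1 trmx); rewrite trmx_mul trmxK trmx0 => /kerM ->.
    exact: submxMl.
  move=> xK; apply: submx_trans xK _; apply/row_subP => i; apply/sub_kermxP.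
  by apply: trmx_inj; rewrite trmx_mul trmxK trmx0.
by rewrite -{1}rankK -(eqmxP eqK) mxrank_ker mxrank_tr subnKC // rank_leq_col.
Qed.

Lemma connect_invariant {T : finType} {S : eqType} {e : rel T} (f : T -> S) :
  symmetric e -> (forall x y, e x y -> f x = f y) ->
  forall x y, connect e x y -> f x = f y.
Proof.
move=> sym_e fP x y exy.
have cl : closed e [pred z | f x == f z] by move=> u v /fP; rewrite !inE => ->.
by have := closed_connect cl exy; rewrite !inE eqxx => /esym/eqP.
Qed.

Section Components.

Context {n : nat} (G : colored_graph n).
Implicit Types (W C D : {set 'I_n}) (i j v w : 'I_n).

Lemma adj_in_sym W : symmetric (adj_in G W).
Proof. by move=> x y; rewrite /adj_in /= setUC andbCA. Qed.

Lemma adj_inT i j : adj_in G [set: 'I_n] i j = ([set i; j] \in edges G).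
Proof. by rewrite /adj_in /= !inE. Qed.

Lemma component_sub {W C} : C \in components G W -> C \subset W.
Proof. by case/imsetP=> x _ ->; apply/subsetP => y; rewrite inE => /andP[]. Qed.

Lemma component_neq0 {W C} : C \in components G W -> exists v, v \in C.
Proof. by case/imsetP=> x xW ->; exists x; rewrite inE xW connect0. Qed.

Lemma component_exists {W v} :
  v \in W -> exists2 C, C \in components G W & v \in C.
Proof.
move=> vW; exists [set y in W | connect (adj_in G W) v y]; first exact: imset_f.
by rewrite inE vW connect0.
Qed.

(** Any member of [C] can replace the base point from which the class was formed, since
    connectedness is symmetric. *)
Lemma component_connect {W C i j} : C \in components G W -> i \in C ->
  (j \in C) = (j \in W) && connect (adj_in G W) i j.
Proof.
case/imsetP=> x _ ->; rewrite !inE => /andP[_ xi].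
by rewrite (same_connect (sym_connect_sym (adj_in_sym W)) xi).
Qed.

Lemma component_eq {W C D v} : C \in components G W -> D \in components G W ->
  v \in C -> v \in D -> C = D.
Proof.
move=> CP DP vC vD; apply/setP => j.
by rewrite (component_connect CP vC) (component_connect DP vD).
Qed.

Lemma colorless_part_color {v} : v \in colorless_part G -> color G v = 0.
Proof.
case/bigcupP=> C /andP[_ /forallP/(_ v)] + vC; rewrite vC /colored.
by have := colorP G v; rewrite !inE => /or3P[] /eqP ->.
Qed.

Lemma colorless_part_closed {i j} : [set i; j] \in edges G ->
  i \in colorless_part G -> j \in colorless_part G.
Proof.
rewrite -adj_inT => ij /bigcupP[C /andP[CP colC] iC].
apply/bigcupP; exists C; first by rewrite CP.
by rewrite (component_connect CP iC) in_setT connect1.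
Qed.

Lemma colored_connect {v} : v \notin colorless_part G ->
  exists2 w, connect (adj_in G [set: 'I_n]) v w & colored G w.
Proof.
move=> vW; have [C CP vC] := component_exists (in_setT v).
have /forall_inPn[w wC] : ~~ [forall w in C, ~~ colored G w].
  by apply: contra vW => colC; apply/bigcupP; exists C; rewrite ?CP.
rewrite negbK => colw; exists w => //.
by move: wC; rewrite (component_connect CP vC) in_setT.
Qed.

(** No edge of [G] leaves the colorless part, so the edge survives in the induced subgraph. *)
Lemma component_edge {C i j} : C \in components G (colorless_part G) ->
  [set i; j] \in edges G -> i \in C -> j \in C.
Proof.
move=> CP ij iC; have iW := subsetP (component_sub CP) i iC.
have jW := colorless_part_closed ij iW.
by rewrite (component_connect CP iC) jW connect1 // /adj_in /= iW jW.
Qed.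

End Components.

Section Kernel.

Context {R : realType} {n : nat} (G : colored_graph n).
Implicit Types (x y : 'rV[R]_n) (C A W : {set 'I_n}) (i j v w : 'I_n).

Lemma mul_sum_delta x (P : pred 'I_n) :
  (\sum_(v | P v) delta_mx 0 v *m x^T : 'M_1) = (\sum_(v | P v) x 0 v)%:M.
Proof.
rewrite raddf_sum; apply: eq_bigr => v _.
by rewrite -rowE; apply/matrixP => a b; rewrite !ord1 !mxE eqxx mulr1n.
Qed.

Lemma c_incidence_kerP x : c_incidence R G *m x^T = 0 <->
  (forall i j, [set i; j] \in edges G -> x 0 j = - x 0 i) /\
  (forall v, color G v != 0 -> x 0 v = 0).
Proof.
have edgeE i j : [set i; j] \in edges G ->
    \sum_(v in [set i; j]) x 0 v = x 0 i + x 0 j.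
  (* The cardinality condition excludes [i = j], where the sum would count [x 0 i] only once. *)
  move=> /edges_card2; rewrite cards2; case: eqVneq => // ij _.
  by rewrite big_setU1 ?inE //= big_set1.
rewrite /c_incidence mul_col_mx -[RHS]col_mx0.
split=> [/eq_col_mx[/row_matrixP eE /row_matrixP cE] | [eE cE]].
  split=> [i j ij | v colv].
    have := eE (enum_rank_in ij [set i; j]).
    rewrite row_mul rowK enum_rankK_in // mulmx_suml mul_sum_delta row0.
    move=> /matrixP/(_ 0 0); rewrite !mxE eqxx mulr1n edgeE // => /eqP.
    by rewrite addrC addr_eq0 => /eqP.
  have := cE v; rewrite row_mul rowK row0 -scalemxAl -rowE.
  move=> /matrixP/(_ 0 0); rewrite !mxE => /eqP.
  by rewrite mulf_eq0 intr_eq0 (negPf colv) => /eqP.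
congr col_mx; apply/row_matrixP => k; rewrite row_mul rowK row0.
  have ke := enum_valP k; rewrite mulmx_suml mul_sum_delta.
  have /eqP/cards2P[i [j [_ kE]]] := edges_card2 ke.
  move: ke; rewrite kE => ke; rewrite edgeE // (eE _ _ ke) subrr.
  by apply/matrixP => a b; rewrite !mxE mul0rn.
rewrite -scalemxAl -rowE; apply/matrixP => a b; rewrite !ord1 !mxE.
by case: (eqVneq (color G k) 0) => [-> | /cE ->]; rewrite ?mul0r ?mulr0.
Qed.

(* On an edge both vectors change sign, so their product does not change. *)
Lemma ker_mul_connect {x y W v w} :
  c_incidence R G *m x^T = 0 -> c_incidence R G *m y^T = 0 ->
  connect (adj_in G W) v w -> x 0 v * y 0 v = x 0 w * y 0 w.
Proof.
move=> /c_incidence_kerP[xE _] /c_incidence_kerP[yE _].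
apply: (connect_invariant (fun u => x 0 u * y 0 u)); first exact: adj_in_sym.
by move=> i j /and3P[_ _ ij]; rewrite (xE _ _ ij) (yE _ _ ij) mulrNN.
Qed.

(** Pairing [x] with itself shows that its squared entries are constant along paths. *)
Lemma ker_connect_eq0 {x W v w} : c_incidence R G *m x^T = 0 ->
  connect (adj_in G W) v w -> (x 0 v == 0) = (x 0 w == 0).
Proof.
move=> kx vw; have := ker_mul_connect kx kx vw.
by rewrite -!expr2 -(sqrf_eq0 (x 0 v)) => ->; rewrite sqrf_eq0.
Qed.

Lemma ker_colored_component {x v} : c_incidence R G *m x^T = 0 ->
  v \notin colorless_part G -> x 0 v = 0.
Proof.
move=> kx /colored_connect[w vw colw]; apply/eqP.
rewrite (ker_connect_eq0 kx vw).
have [_ ->] := (c_incidence_kerP x).1 kx; first by [].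
by case/orP: colw => /eqP ->.
Qed.

Lemma ker_nonbipartite {x C v} : c_incidence R G *m x^T = 0 ->
  C \in components G (colorless_part G) -> v \in C -> ~~ bipartite G C ->
  x 0 v = 0.
Proof.
move=> kx CP vC; apply: contraNeq => xv0.
(* As [x] vanishes nowhere on [C], exactly one of the opposite entries at the ends of an edge is
   positive. *)
apply/existsP; exists [set w | 0 < x 0 w].
apply/forallP => i; apply/forallP => j; apply/implyP => /and3P[iC _ ij].
have xi0 : x 0 i != 0.
  move: iC; rewrite (component_connect _ CP vC) => /andP[_ vi].
  by rewrite -(ker_connect_eq0 kx vi).
have [xE _] := (c_incidence_kerP x).1 kx.
by rewrite !inE (xE _ _ ij) oppr_gt0; case: ltrgtP xi0.
Qed.

(** The signed indicator of [C]: -1 on [C :&: A] and 1 on the rest of [C]. The side [A] may contain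
    vertices outside [C], where the first factor gives 0. *)
Definition side_row C A : 'rV[R]_n := \row_v ((v \in C)%:R * (-1) ^+ (v \in A)).

Lemma side_row_out {C A v} : v \notin C -> side_row C A 0 v = 0.
Proof. by rewrite mxE => /negPf ->; rewrite mul0r. Qed.

Lemma side_row_sqr {C A v} : v \in C -> side_row C A 0 v * side_row C A 0 v = 1.
Proof. by rewrite mxE => ->; rewrite !mul1r -expr2 sqrr_sign. Qed.

(** An edge has both ends in [C], where the signs are opposite, or neither, where both entries are
    0. Colored vertices lie outside [C]. *)
Lemma side_row_ker {C A} : C \in components G (colorless_part G) ->
  (forall i j, adj_in G C i j -> (i \in A) != (j \in A)) ->
  c_incidence R G *m (side_row C A)^T = 0.
Proof.
move=> CP bip; apply/c_incidence_kerP; split=> [i j ij | v].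
  have ji : [set j; i] \in edges G by rewrite setUC.
  case: (boolP (i \in C)) => iC.
    have jC := component_edge _ CP ij iC.
    have /bip : adj_in G C i j by rewrite /adj_in /= iC jC.
    rewrite !mxE iC jC !mul1r.
    by do 2!case: (_ \in A); rewrite //= ?opprK.
  rewrite !side_row_out ?oppr0 //.
  by apply: contra iC; apply: component_edge CP ji.
apply: contraNeq => yv0; apply/eqP/colorless_part_color.
apply: (subsetP (component_sub _ CP)).
by apply: contraNT yv0 => vC; rewrite side_row_out.
Qed.

End Kernel.

Theorem theorem2 (R : realType) (n : nat) (G : colored_graph n) :
  (c_rank R G)%:Z = n%:Z - (delta G)%:Z.
Proof.
suff nE : (c_rank R G + delta G)%N = n.
  by apply/eqP; rewrite eq_sym subr_eq -PoszD nE.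
rewrite /c_rank /delta.
set B := [set C in _ | _].
pose C (k : 'I_#|B|) : {set 'I_n} := enum_val k.
have CB k : (C k \in components G (colorless_part G)) && bipartite G (C k).
  by have := enum_valP k; rewrite inE.
have CP k : C k \in components G (colorless_part G) by case/andP: (CB k).
have /fin_all_exists[rep repC] k : exists v, v \in C k.
  exact: component_neq0 (CP k).
have /fin_all_exists[A bipA] k : exists A : {set 'I_n},
    forall i j, adj_in G (C k) i j -> (i \in A) != (j \in A).
  case/andP: (CB k) => _ /existsP[A /forallP bipA]; exists A => i j.
  by apply/implyP; move: j; apply/forallP.
pose y k := side_row (R := R) (C k) (A k).
have ky k : c_incidence R G *m (y k)^T = 0.
  exact: side_row_ker (CP k) (bipA k).
(* Distinct components are disjoint, so the vectors [y k] have disjoint supports. *)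
have y_out k l v : v \in C k -> l != k -> y l 0 v = 0.
  move=> vk; apply: contraNeq => yv0; apply/eqP/enum_val_inj.
  apply: (component_eq _ (CP l) (CP k) _ vk).
  by apply: contraNT yv0 => vl; rewrite /y side_row_out.
pose K := \matrix_k y k.
(* The coordinate of [x] along [y k] is read off at [rep k]: there [y k] is 1 or -1, hence its own
   inverse, and multiplying by it replaces division. *)
pose L := \matrix_(v, k) ((v == rep k)%:R * y k 0 v).
have mulL (x : 'rV_n) k : (x *m L) 0 k = x 0 (rep k) * y k 0 (rep k).
  rewrite mxE (bigD1 (rep k)) //= big1 ?addr0 => [|v /negPf vk].
    by rewrite mxE eqxx mul1r.
  by rewrite mxE vk mul0r mulr0.
apply: (mxrank_ker_basis _ _ _ _ _ K L) => [k | | x kx].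
- by rewrite rowK.
- apply/row_matrixP => k; apply/rowP => l.
  rewrite row_mul rowK mulL row1 [RHS]mxE eqxx /=.
  case: (eqVneq k l) => [<- | kl]; first exact: side_row_sqr.
  by rewrite (y_out _ _ _ (repC l) kl) mul0r.
apply/rowP => v; rewrite mxE.
(* On [C k] only the term of [y k] survives, and [x 0 v * y k 0 v] has the same value at [v] as at
   [rep k]. *)
have [/existsP[k vk] | vB] := boolP [exists k, v \in C k].
  rewrite (bigD1 k) //= big1 ?addr0 => [|l lk].
    have := component_connect _ (j := v) (CP k) (repC k); rewrite vk.
    move=> /esym/andP[_ /(ker_mul_connect _ kx (ky k)) repE].
    by rewrite mulL repE [K _ _]mxE -mulrA side_row_sqr ?mulr1.
  by rewrite [K _ _]mxE (y_out _ _ _ vk lk) mulr0.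
(* Outside all [C k] every term is 0, and so is [x 0 v]: the component of [v] in [G] has a colored
   vertex, or [v] lies in a non-bipartite component of the colorless part. *)
rewrite big1 => [|k _].
  case: (boolP (v \in colorless_part G)); last exact: ker_colored_component.
  move=> /(component_exists G)[D DP vD]; apply: (ker_nonbipartite _ kx DP vD).
  apply: contra vB => bipD; apply/existsP.
  have DB : D \in B by rewrite inE DP.
  by exists (enum_rank_in DB D); rewrite /C enum_rankK_in.
rewrite [K _ _]mxE side_row_out ?mulr0 //.
by apply: contra vB => vk; apply/existsP; exists k.
Qed.
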